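(* Consider the Hilbert expansion $f=\sum_{i\ge0}\varepsilon^if_i$, with angular mean $\beta=\frac12\int_{-1}^1f\,d\mu=\sum_{i\ge0}\varepsilon^i\beta_i$, $\beta_i=\frac12\int_{-1}^1f_i\,d\mu$, for the time-scaled Boltzmann equation $$\varepsilon\mathcal D^+(f)+\mathcal D^-(f)=j+\mathcal J(f),$$ and a decomposition $f=f^t+f^s$ inducing $\beta=\beta^t+\beta^s$ with $\beta^t=\frac12\int_{-1}^1f^t\,d\mu$, $\beta^s=\frac12\int_{-1}^1f^s\,d\mu$. Then, with $f^s=f_0$ and thus $\beta^s=\beta_0$ and $\beta^t=\beta-\beta^s=\mathcal O(\varepsilon)$, the stationary state equation $$\frac1{r^2}\frac{\partial}{\partial r}\Big(r^2\,\frac12\int_{-1}^1f^s\mu\,d\mu\Big)=j-\tilde\chi\beta^s$$ is an approximation of the angular mean of this time-scaled Boltzmann equation of order $\mathcal O(\varepsilon)$. In addition, $\Sigma_{\rm free}:=j$ is an approximation of order $\mathcal O(\varepsilon)$ of the (angular mean of the) diffusion source $\Sigma$ in the streaming particle equation $$\frac1{r^2}\frac{\partial}{\partial r}\Big(\frac{r^2}2\int_{-1}^1f^s\mu\,d\mu\Big)=-\frac{\tilde\chi}2\int_{-1}^1f^s\,d\mu+\Sigma .$$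
   Context: Variables: time, radius $r>0$, cosine of the propagation angle $\mu\in[-1,1]$, energy $\omega>0$; $f=f(t,r,\mu,\omega)$. The constant $c>0$ is the speed of light; $\rho>0$ and $v$ are given functions of time and $r$ (density and radial velocity of the background matter), and $\frac{d}{dt}:=\frac{\partial}{\partial t}+v\frac{\partial}{\partial r}$. Define $$\mathcal D^+(f)=\frac{df}{c\,dt}+\mu\Big(\frac{d\ln\rho}{c\,dt}+\frac{3v}{cr}\Big)(1-\mu^2)\frac{\partial f}{\partial\mu}+\Big[\mu^2\Big(\frac{d\ln\rho}{c\,dt}+\frac{3v}{cr}\Big)-\frac v{cr}\Big]\omega\frac{\partial f}{\partial\omega},$$ $$\mathcal D^-(f)=\mu\frac{\partial f}{\partial r}+\frac1r(1-\mu^2)\frac{\partial f}{\partial\mu}.$$ The unscaled Boltzmann equation is $\mathcal D^+(f)+\mathcal D^-(f)=j+\mathcal J(f)$; the time-scaled equation results from the substitution $t=\bar t/\varepsilon$, $v=\varepsilon\bar v$ with a small parameter $\varepsilon>0$, and in it $\mathcal D^+$ is understood with $\bar t,\bar v$ (independent of $\varepsilon$) in place of $t,v$. The functions $j\ge0$ (emissivity), $\chi\ge0$ (absorptivity), $\tilde\chi=j+\chi$ do not depend on $\mu$; here $j$, $\tilde\chi$, $\mathcal J$ are not scaled with $\varepsilon$. $\mathcal J(f)=-\tilde\chi f+\mathcal C(f)$, where the collision term is $$\mathcal C(f)(\mu)=\frac{\omega^2}{c(hc)^3}\int_{-1}^1R(\mu,\mu',\omega)\big(f(\mu')-f(\mu)\big)\,d\mu'$$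 with Planck's constant $h$ and a kernel $R$ (also depending on time and $r$) symmetric in $\mu,\mu'$; in particular $\int_{-1}^1\mathcal C(f)\,d\mu=0$ for all $f$. The $f_i$ solve the hierarchy $\mathcal D^-(f_0)=j+\mathcal J(f_0)$, $\mathcal D^+(f_{i-1})+\mathcal D^-(f_i)=\mathcal J(f_i)$, $i=1,2,\dots$. Meaning of the conclusion: the angular mean of the time-scaled Boltzmann equation is $\frac12\int_{-1}^1(\varepsilon\mathcal D^+(f)+\mathcal D^-(f))\,d\mu=j-\tilde\chi\beta$; the conclusion states that the stationary state equation holds and agrees with it up to $\mathcal O(\varepsilon)$, i.e. the left-hand sides agree up to $\mathcal O(\varepsilon)$ and the right-hand sides agree up to $\mathcal O(\varepsilon)$; and that the source $\Sigma$ determined by the streaming particle equation agrees with $j$ in the same sense. All series are formal; series, integrals and partial derivatives are assumed to be interchangeable; $\mathcal O(\varepsilon^k)$ denotes, in the formal sense, the neglected part starting with order $\varepsilon^k$ of a formal series in $\varepsilon$. *)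

(* Defs.v *)
From HB Require Import structures.
From mathcomp Require Import all_boot all_order all_algebra.
From mathcomp Require Import all_classical all_reals all_analysis.
Set Implicit Arguments.
Unset Strict Implicit.
Unset Printing Implicit Defensive.
Import Order.TTheory GRing.Theory Num.Theory.
Import numFieldNormedType.Exports.
Local Open Scope classical_set_scope.
Local Open Scope ring_scope.

(* Functions are total on R; only their values for r > 0, -1 <= mu <= 1 and
   omega > 0 are meaningful, which is why equality is taken on that domain. *)

(* argument order: t, r, mu, omega *)
Notation phase R := (R -> R -> R -> R -> R).
(* argument order: t, r, omega *)
Notation moment R := (R -> R -> R -> R).

Definition phase_eq (R : realType) (a b : phase R) : Prop :=
  forall t r mu om : R, 0 < r -> -1 <= mu <= 1 -> 0 < om ->
    a t r mu om = b t r mu om.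

Definition moment_eq (R : realType) (a b : moment R) : Prop :=
  forall t r om : R, 0 < r -> 0 < om -> a t r om = b t r om.

(* A formal series sum_i eps^i a_i is its sequence of coefficients i |-> a_i;
   linear operators act on it coefficientwise, and eps is an indeterminate. *)
Definition series_cst (V : zmodType) (a : V) : nat -> V :=
  fun i => if i is 0%N then a else 0.

(* multiplication by eps *)
Definition series_eps (V : zmodType) (a : nat -> V) : nat -> V :=
  fun i => if i is k.+1 then a k else 0.

Definition phase_series_eq (R : realType) (a b : nat -> phase R) : Prop :=
  forall i, phase_eq (a i) (b i).

Definition moment_series_eq (R : realType) (a b : nat -> moment R) : Prop :=
  forall i, moment_eq (a i) (b i).

(* a = O(eps^k) in the formal sense *)
Definition formal_bigO (R : realType) (k : nat) (a : nat -> moment R) : Prop :=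
  forall i, (i < k)%N -> moment_eq (a i) 0.

Definition ang_int (R : realType) (g : R -> R) : R :=
  \int[lebesgue_measure]_(mu in `[-1, 1]) g mu.

Definition ang_mean (R : realType) (f : phase R) : moment R :=
  fun t r om => 2^-1 * ang_int (fun mu => f t r mu om).

(* At mu = -1 and mu = 1 the factor 1 - mu^2 vanishes, so that the (total)
   mu-derivative taken there plays no role in Dplus and Dminus. *)
Definition d_t (R : realType) (f : phase R) : phase R :=
  fun t r mu om => derive1 (fun s => f s r mu om) t.
Definition d_r (R : realType) (f : phase R) : phase R :=
  fun t r mu om => derive1 (fun s => f t s mu om) r.
Definition d_mu (R : realType) (f : phase R) : phase R :=
  fun t r mu om => derive1 (fun s => f t r s om) mu.
Definition d_om (R : realType) (f : phase R) : phase R :=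
  fun t r mu om => derive1 (fun s => f t r mu s) om.

(* d ln(rho) / dt with d/dt = partial_t + v partial_r *)
Definition dln (R : realType) (rho v : R -> R -> R) (t r : R) : R :=
  derive1 (fun s => ln (rho s r)) t + v t r * derive1 (fun s => ln (rho t s)) r.

Definition Dplus (R : realType) (c : R) (rho v : R -> R -> R)
    (f : phase R) : phase R :=
  fun t r mu om =>
    c^-1 * (d_t f t r mu om + v t r * d_r f t r mu om)
    + mu * (c^-1 * dln rho v t r + 3 * v t r / (c * r))
      * (1 - mu ^+ 2) * d_mu f t r mu om
    + (mu ^+ 2 * (c^-1 * dln rho v t r + 3 * v t r / (c * r))
       - v t r / (c * r)) * om * d_om f t r mu om.

Definition Dminus (R : realType) (f : phase R) : phase R :=
  fun t r mu om =>
    mu * d_r f t r mu om + r^-1 * (1 - mu ^+ 2) * d_mu f t r mu om.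

(* The kernel takes its arguments in the order t, r, mu, mu', omega. *)
Definition collision (R : realType) (c h : R)
    (K : R -> R -> R -> R -> R -> R) (f : phase R) : phase R :=
  fun t r mu om => om ^+ 2 / (c * (h * c) ^+ 3)
    * ang_int (fun mu' => K t r mu mu' om * (f t r mu' om - f t r mu om)).

Definition chi_tilde (R : realType) (j chi : moment R) : moment R :=
  fun t r om => j t r om + chi t r om.

Definition Jop (R : realType) (c h : R) (K : R -> R -> R -> R -> R -> R)
    (j chi : moment R) (f : phase R) : phase R :=
  fun t r mu om =>
    - chi_tilde j chi t r om * f t r mu om + collision c h K f t r mu om.

Definition isotropic (R : realType) (a : moment R) : phase R :=
  fun t r _ om => a t r om.

(* The two sides of eps D^+(f) + D^-(f) = j + J(f), as formal series. *)
Definition boltzmann_lhs (R : realType) (c : R) (rho v : R -> R -> R)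
    (f : nat -> phase R) : nat -> phase R :=
  fun i => series_eps (fun k => Dplus c rho v (f k)) i + Dminus (f i).

Definition boltzmann_rhs (R : realType) (c h : R)
    (K : R -> R -> R -> R -> R -> R) (j chi : moment R)
    (f : nat -> phase R) : nat -> phase R :=
  fun i => series_cst (isotropic j) i + Jop c h K j chi (f i).

Definition hilbert_hierarchy (R : realType) (c h : R) (rho v : R -> R -> R)
    (K : R -> R -> R -> R -> R -> R) (j chi : moment R)
    (f : nat -> phase R) : Prop :=
  phase_eq (Dminus (f 0%N)) (isotropic j + Jop c h K j chi (f 0%N)) /\
  forall i, phase_eq (Dplus c rho v (f i) + Dminus (f i.+1))
                     (Jop c h K j chi (f i.+1)).

Definition ang_mean_series (R : realType) (f : nat -> phase R)
    : nat -> moment R := fun i => ang_mean (f i).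

(* (1/r^2) d/dr (r^2 (1/2) int f mu dmu) *)
Definition stationary_lhs (R : realType) (f : nat -> phase R)
    : nat -> moment R :=
  fun i t r om => (r ^+ 2)^-1 *
    derive1 (fun s => s ^+ 2 * (2^-1 * ang_int (fun mu => f i t s mu om * mu))) r.

(* j - chi_tilde b *)
Definition mean_rhs (R : realType) (j chi : moment R) (b : nat -> moment R)
    : nat -> moment R :=
  fun i t r om => series_cst j i t r om - chi_tilde j chi t r om * b i t r om.

Definition stationary_state (R : realType) (j chi : moment R)
    (fs : nat -> phase R) : Prop :=
  moment_series_eq (stationary_lhs fs) (mean_rhs j chi (ang_mean_series fs)).

Definition streaming_equation (R : realType) (j chi : moment R)
    (fs : nat -> phase R) (Sigma : nat -> moment R) : Prop :=
  moment_series_eq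
    (fun i t r om => (r ^+ 2)^-1 *
       derive1 (fun s => s ^+ 2 / 2 * ang_int (fun mu => fs i t s mu om * mu)) r)
    (fun i t r om =>
       - (chi_tilde j chi t r om / 2) * ang_int (fun mu => fs i t r mu om)
       + Sigma i t r om).

(* Smoothness that gives the operators above a meaning, and validity of
   the interchange of d/dr with the integral over mu. *)
Record regular (R : realType) (f : phase R) : Prop := Regular {
  regular_t : forall t r mu om : R, 0 < r -> -1 <= mu <= 1 -> 0 < om ->
    derivable (fun s => f s r mu om) t 1;
  regular_r : forall t r mu om : R, 0 < r -> -1 <= mu <= 1 -> 0 < om ->
    derivable (fun s => f t s mu om) r 1;
  regular_om : forall t r mu om : R, 0 < r -> -1 <= mu <= 1 -> 0 < om ->
    derivable (fun s => f t r mu s) om 1;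
  regular_mu : forall t r mu om : R, 0 < r -> -1 < mu < 1 -> 0 < om ->
    derivable (fun s => f t r s om) mu 1;
  regular_mu_cont : forall t r om : R, 0 < r -> 0 < om ->
    {within `[-1, 1], continuous (fun mu => f t r mu om)};
  regular_dmu_cont : forall t r om : R, 0 < r -> 0 < om ->
    {in `]-1, 1[, continuous (fun mu => d_mu f t r mu om)};
  regular_dmu_int : forall t r om : R, 0 < r -> 0 < om ->
    lebesgue_measure.-integrable `[-1, 1]
      (fun mu => ((1 - mu ^+ 2) * d_mu f t r mu om)%:E);
  regular_dr_int : forall t r om : R, 0 < r -> 0 < om ->
    lebesgue_measure.-integrable `[-1, 1]
      (fun mu => (d_r f t r mu om * mu)%:E);
  regular_interchange : forall t r om : R, 0 < r -> 0 < om ->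
    is_derive r 1 (fun s => ang_int (fun mu => f t s mu om * mu))
                  (ang_int (fun mu => d_r f t r mu om * mu))
}.

Definition kernel_symmetric (R : realType)
    (K : R -> R -> R -> R -> R -> R) : Prop :=
  forall t r mu mu' om : R, 0 < r -> -1 <= mu <= 1 -> -1 <= mu' <= 1 ->
    0 < om -> K t r mu mu' om = K t r mu' mu om.

Definition kernel_integrable (R : realType)
    (K : R -> R -> R -> R -> R -> R) : Prop :=
  forall t r om : R, 0 < r -> 0 < om ->
    (forall mu : R, -1 <= mu <= 1 ->
       lebesgue_measure.-integrable `[-1, 1]
         (fun mu' => (K t r mu mu' om)%:E)) /\
    (lebesgue_measure \x lebesgue_measure)%E.-integrable
      (`[-1, 1] `*` `[-1, 1]) (fun p : R * R => (K t r p.1 p.2 om)%:E).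

(* Main.v *)
(** The angular mean of the collision term vanishes, since its integrand is
    antisymmetric in [(mu, mu')], so that integration of each order of the
    Hilbert hierarchy gives [j - chi_tilde * beta_0] at order 0 and
    [- chi_tilde * beta_i] above. On the other side
    [\int (1 - mu^2) d_mu f dmu = 2 \int mu f dmu] by parts, the boundary terms
    being zero, which turns the angular mean of [D^- f_0] into the radial
    divergence of the flux. Hence [f^s = f_0] solves the stationary state
    equation exactly, and both sides of it agree at order 0 with those of the
    angular mean of the Boltzmann equation, where [eps D^+] does not appear. *)

Require Import Defs.
From HB Require Import structures.
From mathcomp Require Import all_boot all_order all_algebra.
From mathcomp Require Import all_classical all_reals all_analysis.
From mathcomp Require Import measurable_realfun ring lra.
Set Implicit Arguments.
Unset Strict Implicit.
Unset Printing Implicit Defensive.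
Import Order.TTheory GRing.Theory Num.Theory.
Import numFieldNormedType.Exports.
Local Open Scope classical_set_scope.
Local Open Scope ring_scope.

(** * Fundamental theorem of calculus for integrable derivatives *)

(* Unlike in [continuous_FTC2], [f] may be unbounded near the endpoints: this is
   all that [regular] grants for [(1 - mu^2) d_mu f]. *)
Lemma integrable_FTC2 (R : realType) (f F : R -> R) (a b : R) : a < b ->
  lebesgue_measure.-integrable `[a, b] (EFin \o f) ->
  {in `]a, b[, continuous f} ->
  {within `[a, b], continuous F} ->
  (forall x, x \in `]a, b[ -> is_derive x 1 F (f x)) ->
  \int[lebesgue_measure]_(x in `[a, b]) f x = F b - F a.
Proof.
move=> ab intf cf cF dF.
(* The primitive [P] of [f] from [a] is continuous up to the endpoints by integrability of [f], and
   [P - F] has derivative 0 inside, so the mean value theorem equates its end values. *)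
pose P x := parameterized_integral lebesgue_measure a x f.
have cPF : {within `[a, b], continuous (P - F)}.
  move=> x; apply: cvgB; last exact: cF.
  exact: (parameterized_integral_continuous (ltW ab) intf).
have dPF x : x \in `]a, b[ -> is_derive x 1 (P - F) (f x - f x).
  move=> xab; move: (xab); rewrite in_itv/= => /andP[ax xb].
  have [dP PE] := continuous_FTC1_closed xb intf ax (cf _ xab).
  apply: is_deriveB (dF _ xab).
  by apply: DeriveDef => //; rewrite -PE derive1E.
have [x _] := MVT ab dPF cPF.
rewrite subrr mul0r /P /parameterized_integral !fctE set_itv1 Rintegral_set1.
by move=> /subr0_eq PF; rewrite -[LHS](subrK (F b)) PF sub0r addrC.
Qed.

(** * Fubini's theorem and antisymmetric integrands on a square *)

Section antisymmetric.
Context d (T : measurableType d) (R : realType).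
Variables (mu : {sigma_finite_measure set T -> \bar R}) (D : set T)
  (g : T -> T -> R).
Hypotheses (mD : measurable D)
  (ig : (mu \x mu)%E.-integrable (D `*` D) (fun p => (g p.1 p.2)%:E))
  (igx : forall x, D x -> mu.-integrable D (EFin \o g x)).

(** Extension by zero, so that Fubini's theorem on the whole product space applies. *)
Let G p : \bar R := ((fun p => (g p.1 p.2)%:E) \_ (D `*` D)) p.

Let GE x y : G (x, y) = (((EFin \o g x) \_ D) y * (\1_D x)%:E)%E.
Proof.
rewrite /G !patchE indicE in_setX.
by case: (x \in D); case: (y \in D); rewrite /= ?mule1 ?mule0.
Qed.

Let iG : (mu \x mu)%E.-integrable setT G.
Proof.
by apply/integrable_restrict; rewrite ?setTI//; exact: measurableX.
Qed.

Let iGx x : mu.-integrable setT (fun y => G (x, y)).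
Proof.
have [xD|xD] := boolP (x \in D).
  rewrite (_ : (fun _ => _) = (EFin \o g x) \_ D).
    by apply/integrable_restrict; rewrite ?setTI//; apply: igx; rewrite inE in xD.
  by apply/funext => y; rewrite GE indicE xD mule1.
rewrite (_ : (fun _ => _) = cst 0%E); first exact: integrable0.
by apply/funext => y; rewrite GE indicE (negbTE xD) mule0.
Qed.

(** Every section over [D] is integrable, so the inner integral is finite and its real-valued
    version loses nothing. *)
Let inner x : (\int[mu]_y G (x, y) =
  ((EFin \o (fun x => \int[mu]_(y in D) g x y)%R) \_ D) x)%E.
Proof.
rewrite patchE; case: ifPn => xD; last first.
  under eq_integral do rewrite GE indicE (negbTE xD) mule0.
  by rewrite integral0.
under eq_integral do rewrite GE indicE xD mule1.
rewrite -integral_mkcond /= /Rintegral fineK//.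
by apply: integrable_fin_num => //; apply: igx; rewrite inE in xD.
Qed.

Lemma integrable_Rintegral_section :
  mu.-integrable D (EFin \o (fun x => \int[mu]_(y in D) g x y)).
Proof.
rewrite -[D in integrable _ D _]setTI; apply/integrable_restrict => //.
have := integrable_fubini_F iG; congr (_.-integrable _ _).
by apply/funext => x; rewrite -inner.
Qed.

(** Exchanging the order of integration turns the iterated integral into its opposite; it is finite,
    hence zero. *)
Lemma Rintegral2_antisymmetric :
  {in D &, forall x y, g x y = - g y x} ->
  \int[mu]_(x in D) \int[mu]_(y in D) g x y = 0.
Proof.
move=> gN; rewrite /Rintegral.
have GN x y : G (x, y) = (- G (y, x))%E.
  rewrite /G !patchE !in_setX andbC; case: ifPn; last by rewrite oppe0.
  by move=> /andP[yD xD]; rewrite /= gN.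
rewrite integral_mkcond.
under eq_integral do rewrite -inner.
have : (\int[mu]_x \int[mu]_y G (x, y) = - \int[mu]_x \int[mu]_y G (x, y))%E.
  rewrite [LHS](Fubini iG) -integralN.
    apply: eq_integral => y _; rewrite -integralN.
      by apply: eq_integral => x _; rewrite -GN.
    exact/integrable_add_def/iGx.
  exact/integrable_add_def/(integrable_fubini_F iG).
have : (\int[mu]_x \int[mu]_y G (x, y))%E \is a fin_num.
  exact/integrable_fin_num/(integrable_fubini_F iG).
case: (\int[mu]_x _)%E => //= r _ [].
lra.
Qed.

End antisymmetric.

(** * Bounded functions and scattering integrals *)

Lemma within_segment_bounded (R : realType) (a b : R) (phi : R -> R) :
  {within `[a, b], continuous phi} ->
  exists M, forall x, x \in `[a, b] -> `|phi x| <= M.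
Proof.
move=> cphi.
have /compact_bounded[M [Mr PM]] : compact (phi @` `[a, b]).
  by apply: continuous_compact cphi _; exact: segment_compact.
(* Boundedness provides a bound by each number strictly above [M]. *)
exists (M + 1) => x xab.
by apply: PM; [rewrite ltrDl|exists x].
Qed.

Section scattering.
Context d (T : measurableType d) (R : realType).
Variables (mu : {sigma_finite_measure set T -> \bar R}) (D : set T).
Variables (k : T -> T -> R) (phi : T -> R) (M : R).
Hypotheses (mD : measurable D) (mphi : measurable_fun D phi)
  (PM : forall x, D x -> `|phi x| <= M)
  (ik : (mu \x mu)%E.-integrable (D `*` D) (fun p => (k p.1 p.2)%:E))
  (ikx : forall x, D x -> mu.-integrable D (EFin \o k x)).

(** An integrable kernel is multiplied by a measurable factor bounded by [M + M]. *)
Let ig : (mu \x mu)%E.-integrable (D `*` D)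
  (fun p => (k p.1 p.2 * (phi p.2 - phi p.1))%:E).
Proof.
under eq_fun do rewrite EFinM.
apply: (@integrableMl _ _ _ _ _ (measurableX mD mD)
  (fun p => (k p.1 p.2)%:E) (fun p => phi p.2 - phi p.1)) => //.
- apply: measurable_funB.
  + apply: (measurable_comp (F := D)) => //.
      by move=> _ [[x y] [_ ?] <-].
    by apply: measurable_funTS; exact: measurable_snd.
  + apply: (measurable_comp (F := D)) => //.
      by move=> _ [[x y] [? _] <-].
    by apply: measurable_funTS; exact: measurable_fst.
- exists (M + M); split; first exact: num_real.
  move=> N MN [x y] [/= xD yD] /=; apply: le_trans (ltW MN).
  by apply: le_trans (ler_normB _ _) _; apply: lerD; exact: PM.
Qed.

Let igx x : D x -> mu.-integrable D (EFin \o (fun y => k x y * (phi y - phi x))).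
Proof.
move=> xD.
rewrite (_ : _ \o _ = (fun y => (k x y)%:E * (phi y - phi x)%:E)%E); last first.
  by apply/funext => y; rewrite /= EFinM.
apply: (@integrableMl _ _ _ _ _ mD (EFin \o k x) (fun y => phi y - phi x)) => //.
- exact: ikx.
- exact: measurable_funB.
- exists (M + M); split; first exact: num_real.
  move=> N MN y yD; apply: le_trans (ltW MN).
  by apply: le_trans (ler_normB _ _) _; apply: lerD; exact: PM.
Qed.

Lemma integrable_scattering : mu.-integrable D
  (EFin \o (fun x => \int[mu]_(y in D) (k x y * (phi y - phi x)))).
Proof. exact: integrable_Rintegral_section mD ig igx. Qed.

Lemma Rintegral_scattering : {in D &, forall x y, k x y = k y x} ->
  \int[mu]_(x in D) \int[mu]_(y in D) (k x y * (phi y - phi x)) = 0.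
Proof.
move=> ksym; apply: (Rintegral2_antisymmetric mD ig igx) => x y xD yD.
by rewrite ksym// -mulrN opprB.
Qed.

End scattering.

Lemma integrable_EFinZl d (T : measurableType d) (R : realType)
    (mu : {measure set T -> \bar R}) (D : set T) (a : R) (g : T -> R) :
  measurable D -> mu.-integrable D (EFin \o g) ->
  mu.-integrable D (EFin \o (fun x => a * g x)).
Proof.
move=> mD ig; rewrite (_ : _ \o _ = (fun x => a%:E * (g x)%:E)%E).
  exact: (integrableZl mD a ig).
by apply/funext => x; rewrite /= EFinM.
Qed.

(** * Angular mean of the operator $D^-$ *)

Section streaming_mean.
Context (R : realType) (f : phase R) (t r om : R).
Hypotheses (fr : regular f) (r0 : 0 < r) (om0 : 0 < om).
Let mu := @lebesgue_measure R.

Lemma regular_integrable :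
  mu.-integrable `[-1, 1] (EFin \o (fun m => f t r m om)).
Proof.
apply: continuous_compact_integrable; first exact: segment_compact.
exact: regular_mu_cont.
Qed.

Lemma regular_flux_integrable :
  mu.-integrable `[-1, 1] (EFin \o (fun m => f t r m om * m)).
Proof.
apply: continuous_compact_integrable; first exact: segment_compact.
have cid : {within `[-1, 1], continuous (@id R)}.
  by apply: continuous_subspaceT => y; exact: cvg_id.
by move=> x; apply: cvgM; [exact: (regular_mu_cont fr)|exact: cid].
Qed.

(** The function $(1 - m^2) f$ vanishes at both ends and has derivative $(1 - m^2) \partial_\mu f -
    2 m f$, whose integral is therefore zero. *)
Lemma ang_int_d_mu :
  ang_int (fun m => (1 - m ^+ 2) * d_mu f t r m om) =
  2 * ang_int (fun m => f t r m om * m).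
Proof.
have i1 := regular_dmu_int fr t r0 om0.
have i2 := regular_flux_integrable.
have i2' : mu.-integrable `[-1, 1] (EFin \o (fun m => 2 * (f t r m om * m))).
  exact: integrable_EFinZl.
apply/subr0_eq; rewrite /ang_int -RintegralZl// -RintegralB//.
transitivity ((1 - 1 ^+ 2) * f t r 1 om - (1 - (-1) ^+ 2) * f t r (-1) om);
  last by rewrite sqrrN expr1n subrr !mul0r subrr.
apply: (@integrable_FTC2 _ _ (fun m => (1 - m ^+ 2) * f t r m om)).
- lra.
- exact: integrableB i1 i2'.
- move=> x xI; have x11 : -1 < x < 1 by rewrite in_itv in xI.
  have cf : {for x, continuous (fun m => f t r m om)}.
    apply: differentiable_continuous; apply/derivable1_diffP.
    exact: (regular_mu fr).
  apply: cvgB.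
    apply: cvgM; last exact: (regular_dmu_cont fr).
    by apply: cvgB; [exact: cvg_cst|exact: exprn_continuous].
  by apply: cvgM; [exact: cvg_cst|apply: cvgM => //; exact: cvg_id].
- have c1 : {within `[-1, 1], continuous (fun m : R => 1 - m ^+ 2)}.
    apply: continuous_subspaceT => y.
    by apply: cvgB; [exact: cvg_cst|exact: exprn_continuous].
  by move=> x; apply: cvgM; [exact: c1|exact: (regular_mu_cont fr)].
- move=> x xI; have x11 : -1 < x < 1 by rewrite in_itv in xI.
  have df : is_derive x 1 (fun m => f t r m om) (d_mu f t r x om).
    by apply: DeriveDef; [exact: (regular_mu fr)|rewrite /d_mu derive1E].
  have d1 : is_derive x 1 (fun m : R => 1 - m ^+ 2) (- (2 * x)).
    by apply: is_derive_eq; rewrite /= /GRing.scale/=; ring.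
  apply: is_derive_eq; rewrite /GRing.scale /=; ring.
Qed.

(** With $u(r) = \int f \mu \, d\mu$, both sides equal $u / r + u' / 2$: the left one by
    [ang_int_d_mu] and the interchange of $d/dr$ with the integral, the right one by the product
    rule. *)
Lemma ang_mean_Dminus : ang_mean (Dminus f) t r om =
  (r ^+ 2)^-1 * derive1
    (fun s => s ^+ 2 * (2^-1 * ang_int (fun m => f t s m om * m))) r.
Proof.
have dI := regular_interchange fr t r0 om0.
have i1 := regular_dr_int fr t r0 om0.
have i2 := regular_dmu_int fr t r0 om0.
rewrite derive1E.
set u := fun s => ang_int _ in dI *.
have du : is_derive r 1 (fun s => s ^+ 2 * (2^-1 * u s))
   (2 * r * (2^-1 * u r)
    + r ^+ 2 * (2^-1 * ang_int (fun m => d_r f t r m om * m))).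
  by apply: is_derive_eq; rewrite /GRing.scale /=; ring.
rewrite derive_val /ang_mean /Dminus /ang_int.
(* The two summands take the forms whose integrability [regular] grants. *)
under eq_Rintegral do rewrite mulrC -mulrA.
rewrite RintegralD//; last exact: integrable_EFinZl.
rewrite RintegralZl// -/(ang_int _) -/(ang_int _) ang_int_d_mu -/(u r).
by field; rewrite gt_eqF.
Qed.

End streaming_mean.

(** * Elementary properties of angular integrals *)

Lemma eq_ang_int (R : realType) (g1 g2 : R -> R) :
  (forall m, -1 <= m <= 1 -> g1 m = g2 m) -> ang_int g1 = ang_int g2.
Proof.
by move=> g12; apply: eq_Rintegral => m; rewrite inE/= in_itv/=; exact: g12.
Qed.

Lemma eq_ang_mean (R : realType) (a b : phase R) :
  phase_eq a b -> moment_eq (ang_mean a) (ang_mean b).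
Proof.
by move=> ab t r om r0 om0; congr (_ * _); apply: eq_ang_int => m m1; exact: ab.
Qed.

Lemma ang_int_cst (R : realType) (a : R) : ang_int (cst a) = 2 * a.
Proof.
rewrite /ang_int Rintegral_cst//= lebesgue_measure_itv/= lte_fin ifT; last lra.
rewrite /=; ring.
Qed.

Lemma ang_int0 (R : realType) : @ang_int R (fun=> 0) = 0.
Proof. by rewrite (ang_int_cst 0) mulr0. Qed.

Lemma integrable_ang_cst (R : realType) (a : R) :
  lebesgue_measure.-integrable `[-1, 1] (EFin \o cst a).
Proof.
apply: continuous_compact_integrable; first exact: segment_compact.
by apply: continuous_subspaceT => x; exact: cvg_cst.
Qed.

(** * Angular mean of the right-hand side *)

Section moments.
Context (R : realType) (c h : R) (K : R -> R -> R -> R -> R -> R).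
Context (j chi : moment R) (f : phase R).
Hypotheses (K_sym : kernel_symmetric K) (K_int : kernel_integrable K).
Hypothesis fr : regular f.

(** For fixed [t], [r], [om] this is a constant times a scattering integral of the section of [f] in
    the angle, which is continuous on a segment, hence measurable and bounded. *)
Let collision_mean0 t r om : 0 < r -> 0 < om ->
  lebesgue_measure.-integrable `[-1, 1]
    (EFin \o (fun m => collision c h K f t r m om)) /\
  ang_int (fun m => collision c h K f t r m om) = 0.
Proof.
move=> r0 om0; have [Kx Kxy] := K_int t r0 om0.
have mu_cont := regular_mu_cont fr (t := t) r0 om0.
have [M fM] := within_segment_bounded mu_cont.
have mf := subspace_continuous_measurable_fun (measurable_itv _) mu_cont.
have mI : measurable (`[-1, 1] : set (measurableTypeR R)).
  exact: measurable_itv.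
have iS := @integrable_scattering _ (measurableTypeR R) _ _ _
  (fun m m' => K t r m m' om) _ M mI mf fM Kxy Kx.
split; first exact: integrable_EFinZl.
rewrite /ang_int RintegralZl//.
rewrite (@Rintegral_scattering _ (measurableTypeR R) _ _ _
  (fun m m' => K t r m m' om) _ M mI mf fM Kxy Kx) ?mulr0//.
by move=> x y xI yI; apply: K_sym => //; rewrite !inE/= !in_itv in xI yI.
Qed.

(** The source [a] is left free to serve both order 0, with [j], and the higher orders, with 0. *)
Lemma ang_mean_source_Jop a :
  moment_eq (ang_mean (isotropic a + Jop c h K j chi f))
    (fun t r om => a t r om - chi_tilde j chi t r om * ang_mean f t r om).
Proof.
move=> t r om r0 om0; have [iC C0] := collision_mean0 t r0 om0.
have iF := regular_integrable t fr r0 om0.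
have mI : measurable (`[-1, 1] : set (measurableTypeR R)).
  exact: measurable_itv.
have iXF := integrable_EFinZl (- chi_tilde j chi t r om) mI iF.
have iA := integrable_ang_cst (a t r om).
rewrite /ang_mean.
have -> : ang_int (fun m => (isotropic a + Jop c h K j chi f) t r m om) =
  ang_int (cst (a t r om))
  + (ang_int (fun m => - chi_tilde j chi t r om * f t r m om)
     + ang_int (fun m => collision c h K f t r m om)).
  rewrite /ang_int -RintegralD//= -RintegralD//.
  exact: (integrableD mI iXF iC).
by rewrite C0 ang_int_cst /ang_int RintegralZl//; field.
Qed.

End moments.

(** * Coefficients of the formal series *)

Lemma boltzmann_rhsE (R : realType) (c h : R) (K : R -> R -> R -> R -> R -> R)
    (j chi : moment R) (f : nat -> phase R) (i : nat) :
  boltzmann_rhs c h K j chi f i =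
  isotropic (series_cst j i) + Jop c h K j chi (f i).
Proof. by rewrite /boltzmann_rhs; case: i. Qed.

(** The hierarchy is the equation read coefficientwise: [series_eps] contributes 0 at order 0, and
    [series_cst] gives no source above it. *)
Lemma hilbert_boltzmann (R : realType) (c h : R) (rho v : R -> R -> R)
    (K : R -> R -> R -> R -> R -> R) (j chi : moment R) (f : nat -> phase R) :
  hilbert_hierarchy c h rho v K j chi f ->
  phase_series_eq (boltzmann_lhs c rho v f) (boltzmann_rhs c h K j chi f).
Proof.
move=> [f0 fS] [|i] t r mu om r0 mu1 om0.
  have := f0 t r mu om r0 mu1 om0.
  by rewrite /boltzmann_lhs /boltzmann_rhs /= !fctE add0r.
have := fS i t r mu om r0 mu1 om0.
by rewrite /boltzmann_lhs /boltzmann_rhs /= !fctE add0r.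
Qed.

(** Functions are compared at positive radii only; these form a neighbourhood of [r], which suffices
    for the derivative. *)
Lemma derive1_eq_pos (R : realType) (u w : R -> R) (r : R) : 0 < r ->
  (forall s, 0 < s -> u s = w s) -> derive1 u r = derive1 w r.
Proof.
move=> r0 uw; rewrite !derive1E; apply: near_eq_derive.
by near=> s; apply: uw; near: s; exact: lt_nbhsr.
Unshelve. all: by end_near. Qed.

Lemma eq_stationary_lhs (R : realType) (a b : nat -> phase R) (i : nat) :
  phase_eq (a i) (b i) -> moment_eq (stationary_lhs a i) (stationary_lhs b i).
Proof.
move=> ab t r om r0 om0; congr (_ * _); apply: derive1_eq_pos => // s s0.
congr (_ * (_ * _)); apply: eq_ang_int => m m1; congr (_ * _); exact: ab.
Qed.

Lemma stationary_lhs0 (R : realType) (a : nat -> phase R) (i : nat) :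
  phase_eq (a i) 0 -> moment_eq (stationary_lhs a i) 0.
Proof.
move=> a0 t r om r0 om0.
rewrite (@eq_stationary_lhs _ a (fun=> 0) i)// /stationary_lhs.
rewrite (@derive1_eq_pos _ _ (cst 0))// ?derive1_cst ?mulr0// => s s0.
under eq_ang_int do rewrite mul0r.
by rewrite ang_int0 !mulr0.
Qed.

Lemma ang_mean0 (R : realType) (a : phase R) :
  phase_eq a 0 -> moment_eq (ang_mean a) 0.
Proof.
by move=> a0 t r om r0 om0; rewrite (eq_ang_mean a0)// /ang_mean ang_int0 mulr0.
Qed.

Lemma streaming_lhsE (R : realType) (a : nat -> phase R) (i : nat) (t r om : R) :
  (r ^+ 2)^-1 *
    derive1 (fun s => s ^+ 2 / 2 * ang_int (fun mu => a i t s mu om * mu)) r =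
  stationary_lhs a i t r om.
Proof.
by congr (_ * _); congr derive1; apply/funext => s; rewrite mulrA.
Qed.

(** * Approximation by the stationary state equation *)

Theorem theorem2p22 (R : realType) (c h : R) (rho v : R -> R -> R)
    (K : R -> R -> R -> R -> R -> R) (j chi : R -> R -> R -> R)
    (f ft fs : nat -> R -> R -> R -> R -> R)
    (c_gt0 : 0 < c) (h_gt0 : 0 < h)
    (rho_gt0 : forall t r : R, 0 < r -> 0 < rho t r)
    (rho_dt : forall t r : R, 0 < r -> derivable (fun s => rho s r) t 1)
    (rho_dr : forall t r : R, 0 < r -> derivable (fun s => rho t s) r 1)
    (j_ge0 : forall t r om : R, 0 < r -> 0 < om -> 0 <= j t r om)
    (chi_ge0 : forall t r om : R, 0 < r -> 0 < om -> 0 <= chi t r om)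
    (K_sym : kernel_symmetric K) (K_int : kernel_integrable K)
    (f_reg : forall i, regular (f i))
    (f_hilbert : hilbert_hierarchy c h rho v K j chi f)
    (f_dec : phase_series_eq f (fun i => ft i + fs i))
    (fs_def : phase_series_eq fs (series_cst (f 0%N))) :
  let beta := ang_mean_series f in
  let betat := ang_mean_series ft in
  let betas := ang_mean_series fs in
  let mean_lhs := ang_mean_series (boltzmann_lhs c rho v f) in
  [/\ [/\ moment_series_eq beta (fun i => betat i + betas i),
          moment_series_eq betas (series_cst (beta 0%N)),
          moment_series_eq betat (fun i => beta i - betas i)
        & formal_bigO 1 betat],
      moment_series_eq (ang_mean_series (boltzmann_rhs c h K j chi f))
                       (mean_rhs j chi beta)
        /\ moment_series_eq mean_lhs (mean_rhs j chi beta),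
      stationary_state j chi fs,
      formal_bigO 1 (fun i => mean_lhs i - stationary_lhs fs i)
        /\ formal_bigO 1 (fun i => mean_rhs j chi beta i
                                   - mean_rhs j chi betas i)
    & forall Sigma : nat -> R -> R -> R -> R,
        streaming_equation j chi fs Sigma ->
        formal_bigO 1 (fun i => Sigma i - series_cst j i)].
Proof.
move=> beta betat betas mean_lhs.
have rhsE : moment_series_eq (ang_mean_series (boltzmann_rhs c h K j chi f))
                             (mean_rhs j chi beta).
  move=> i t r om r0 om0; rewrite /ang_mean_series boltzmann_rhsE.
  exact: ang_mean_source_Jop.
have lhsE : moment_series_eq mean_lhs (mean_rhs j chi beta).
  move=> i t r om r0 om0; rewrite -rhsE//.
  exact: (eq_ang_mean (hilbert_boltzmann f_hilbert i)).
have fs0 : phase_eq (fs 0%N) (f 0%N) by exact: fs_def 0%N.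
have fsS i : phase_eq (fs i.+1) 0 by exact: fs_def i.+1.
(* Cancelling [f 0] in $f_0 = f^t_0 + f_0$. *)
have ft0 : phase_eq (ft 0%N) 0.
  move=> t r mu om r0 mu1 om0; have := f_dec 0%N t r mu om r0 mu1 om0.
  rewrite !fctE fs0// => fE; apply: (addIr (f 0%N t r mu om)).
  by rewrite -fE add0r.
have ftS i : phase_eq (ft i.+1) (f i.+1).
  by move=> t r mu om r0 mu1 om0; rewrite f_dec// !fctE fsS// addr0.
have betas0 : moment_eq (betas 0%N) (beta 0%N) by exact: eq_ang_mean.
have betasS i : moment_eq (betas i.+1) 0 by exact: ang_mean0.
have betat0 : moment_eq (betat 0%N) 0 by exact: ang_mean0.
have betatS i : moment_eq (betat i.+1) (beta i.+1) by exact: eq_ang_mean.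
(* Above order 0 both sides vanish; order 0 is the angular mean of the first equation of the
   hierarchy. *)
have stat : stationary_state j chi fs.
  move=> [|i] t r om r0 om0; last first.
    rewrite (stationary_lhs0 (fsS i))// /mean_rhs /= -/betas betasS//.
    by rewrite mulr0 subr0.
  rewrite (@eq_stationary_lhs _ fs f 0%N)// /stationary_lhs -ang_mean_Dminus//.
  rewrite (eq_ang_mean f_hilbert.1)//.
  rewrite (ang_mean_source_Jop c h j chi K_sym K_int (f_reg 0%N))//.
  by rewrite /mean_rhs /= -/betas betas0.
have mean_rhs0 : moment_eq (mean_rhs j chi beta 0%N) (mean_rhs j chi betas 0%N).
  by move=> t r om r0 om0; rewrite /mean_rhs betas0.
split.
- split.
  + move=> [|i] t r om r0 om0; rewrite !fctE.
      by rewrite betat0// betas0// add0r.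
    by rewrite betatS// betasS// addr0.
  + by case=> [|i]; [exact: betas0|exact: betasS].
  + move=> [|i] t r om r0 om0; rewrite !fctE.
      by rewrite betat0// betas0// subrr.
    by rewrite betatS// betasS// subr0.
  + by case.
- by [].
- exact: stat.
(* Only order 0 is compared: there the mean of the left-hand side is $j - \tilde\chi \beta_0$, and
   $\beta_0 = \beta^s_0$. *)
- split; case=> // _ t r om r0 om0; rewrite !fctE.
    by rewrite lhsE// mean_rhs0// -stat// subrr.
  by rewrite mean_rhs0// subrr.
(* At order 0 the streaming and stationary equations share their left-hand side, so the right-hand
   sides give $\Sigma_0 = j$. *)
- move=> Sigma str [|//] _ t r om r0 om0; rewrite !fctE.
  have := str 0%N t r om r0 om0; rewrite streaming_lhsE stat//.
  rewrite /mean_rhs /= /ang_mean_series /ang_mean => E.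
  apply/eqP; rewrite subr_eq0; apply/eqP; lra.
Qed.
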